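(* Let $\bar M=\mathbb{R}\times_p M$, with metric $G=dt\otimes dt+p^2(t)g$ ($p:\mathbb{R}\to\mathbb{R}$ smooth and positive) and complex structure $J$, be a conformal Kähler manifold, where $M$ is an odd-dimensional manifold carrying the almost contact metric structure $(\varphi,\eta_0,\xi_0,g)$ related to $J$ as described in the context. Let $\Omega_G$ be the Kähler form of $\bar M$ and let $f:\bar M\to\mathbb{R}$ be a positive smooth function such that $f\Omega_G$ is closed. If $df=\xi_0(f)\,\eta_0$ and $dp=0$, then $M$ is an almost Kenmotsu manifold.
   Context: An almost contact metric structure $(\varphi,\eta_0,\xi_0,g)$ on a $(2m+1)$-dimensional manifold $M$ consists of a $(1,1)$-tensor field $\varphi$, a vector field $\xi_0$, a 1-form $\eta_0$ and a Riemannian metric $g$ with $\varphi^2X=-X+\eta_0(X)\xi_0$, $\eta_0(\xi_0)=1$, $\eta_0\circ\varphi=0$, $\varphi\xi_0=0$, $g(\varphi X,\varphi Y)=g(X,Y)-\eta_0(X)\eta_0(Y)$ for all vector fields $X,Y$. Its Kähler form is $\Omega_g(X,Y)=g(X,\varphi Y)$. An almost contact metric manifold is called almost Kenmotsu if $d\eta_0=0$ and $d\Omega_g=\beta\,(\eta_0\wedge\Omega_g)$ for some smooth function $\beta$ on $M$. Warped product: $t$ is the coordinate on $\mathbb{R}$, $\bar\xi=\partial/\partial t$, $\bar\eta=dt$. Objects on $\mathbb{R}$ and $M$ are also regarded as objects on $\bar M$. Put $\eta=p\,\eta_0$, $\xi=\xi_0/p$. The almost contact structure on $M$ (as an orientable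 hypersurface of $\bar M$) is related to $J$ by $J|_D=\varphi$, $J\xi=-\bar\xi$, $J\bar\xi=\xi$, where $D=\{X\in T\bar M:\eta(X)=\bar\eta(X)=0\}$. The Kähler form of $\bar M$ is $\Omega_G(\bar X,\bar Y)=G(\bar X,J\bar Y)$; thus $\Omega_G=p^2\Omega_g+p\,\eta_0\wedge\bar\eta$. A Hermitian manifold with Kähler form $\Omega$ is conformal Kähler if $d\Omega=\omega\wedge\Omega$ for some exact 1-form $\omega$; equivalently (in the setting used here) there is a positive smooth function $f$ with $f\Omega$ closed. *)

(* Defs.v *)
From mathcomp Require Import all_boot all_order all_algebra.
From mathcomp Require Import all_classical all_reals all_analysis.
Set Implicit Arguments.
Unset Strict Implicit.
Unset Printing Implicit Defensive.
Import Order.TTheory GRing.Theory Num.Theory.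
Import numFieldNormedType.Exports.
Local Open Scope classical_set_scope.
Local Open Scope ring_scope.

Section Smooth.
Context {R : realType}.
Lemma near_eq_differentiable (E F : normedModType R) (f g : E -> F) (x : E) :
  (\forall y \near x, f y = g y) -> differentiable f x -> differentiable g x.
Proof.
move=> fg /diff_locallyP [dc de].
have fgx : f x = g x by exact: nbhs_singleton fg.
have H : g \o shift x = cst (g x) + 'd f x +o_ 0 id.
  apply/eqaddoP => e e0.
  move/eqaddoP : de => /(_ e e0) de.
  have fg0 : \forall y \near (0 : E), f (y + x) = g (y + x).
    by move: fg; rewrite (near_shift 0 x) subr0 => fg; exact: fg.
  near=> y.
  have -> : (g \o shift x - (cst (g x) + 'd f x)) y
          = (f \o shift x - (cst (f x) + 'd f x)) y.
    rewrite -fgx /= !fctE /=.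
    by have -> : f (y + x) = g (y + x) by near: y.
  by near: y.
have dd : 'd g x = 'd f x :> (E -> F) by exact: diff_unique.
by apply/diff_locallyP; rewrite dd.
Unshelve. all: by end_near.
Qed.


(* C^k on an open subset [U] of a finite-dimensional [E]: all iterated
   directional derivatives exist and are continuous on [U]. *)
Fixpoint Ck (E F : normedModType R) (k : nat) (U : set E) (f : E -> F) : Prop :=
  if k is k'.+1 then
    (forall x, U x -> differentiable f x) /\
    (forall v : E, Ck k' U (fun x => 'D_v f x))
  else forall x, U x -> {for x, continuous f}.

Definition smooth_on (E F : normedModType R) (U : set E) (f : E -> F) : Prop :=
  forall k, Ck k U f.

Lemma Ck_ext (E F : normedModType R) (U : set E) (f g : E -> F) k :
  open U -> (forall x, U x -> f x = g x) -> Ck k U f -> Ck k U g.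
Proof.
move=> oU; elim: k f g => [|k IH] f g fg /=.
  move=> fc x Ux; have Unx : nbhs x U by exact: open_nbhs_nbhs.
  rewrite /prop_for /continuous_at -(fg x Ux).
  apply: cvg_trans (fc x Ux); apply: near_eq_cvg.
  by apply: filterS Unx => y /fg.
have fgx x : U x -> \forall y \near x, f y = g y.
  move=> Ux; have Unx : nbhs x U by exact: open_nbhs_nbhs.
  by apply: filterS Unx => y /fg.
move=> [df dfk]; split=> [x Ux|v].
  exact: near_eq_differentiable (fgx _ Ux) (df x Ux).
by apply: IH (dfk v) => x Ux; exact: near_eq_derive (fgx _ Ux).
Qed.

Lemma smooth_cst (E F : normedModType R) (U : set E) (a : F) :
  smooth_on U (cst a : E -> F).
Proof.
move=> k; elim: k a => [|k IH] a /=; first by move=> x _; exact: cst_continuous.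
split=> [x _|v]; first exact: differentiable_cst.
by under eq_fun do rewrite derive_cst; exact: IH.
Qed.

Lemma smooth_id (E : normedModType R) (U : set E) : smooth_on U (@id E).
Proof.
case=> [|k] /=; first by move=> x _; exact: cvg_id.
split=> // v; under eq_fun do rewrite derive_id; exact: smooth_cst.
Qed.

Lemma Ck_prod (E E' F F' : normedModType R) (U : set E) (V : set E')
    (f : E -> F) (g : E' -> F') k :
  open U -> open V -> open (U `*` V) -> Ck k U f -> Ck k V g ->
  Ck k (U `*` V) (fun z => (f z.1, g z.2)).
Proof.
move=> oU oV oUV; elim: k f g => [|k IH] f g /=.
  move=> cf cg z [Uz Vz]; apply: cvg_pair => /=.
    by apply: continuous_comp; [exact: cvg_fst|exact: cf].
  by apply: continuous_comp; [exact: cvg_snd|exact: cg].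
move=> [df dfk] [dg dgk].
have cfst : continuous (@fst E E') by move=> z; exact: cvg_fst.
have csnd : continuous (@snd E E') by move=> z; exact: cvg_snd.
have dfst z : is_diff z (@fst E E') fst.
  apply: DiffDef; first exact: (@linear_differentiable _ _ _ fst z cfst).
  exact: (@diff_lin _ _ _ fst z cfst).
have dsnd z : is_diff z (@snd E E') snd.
  apply: DiffDef; first exact: (@linear_differentiable _ _ _ snd z csnd).
  exact: (@diff_lin _ _ _ snd z csnd).
have dp (z : E * E') : (U `*` V) z ->
    is_diff z (fun z : E * E' => (f z.1, g z.2))
      (fun w : E * E' => ('d f (z.1) w.1, 'd g (z.2) w.2)).
  move=> [/df dfz /dg dgz].
  apply: is_diff_pair.
    have := is_diff_comp (dfst z) (differentiableP dfz); exact.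
  have := is_diff_comp (dsnd z) (differentiableP dgz); exact.
split=> [z UVz|v].
  exact: (@ex_diff _ _ _ _ _ _ _ (dp z UVz)).
apply: (Ck_ext oUV _ (IH _ _ (dfk v.1) (dgk v.2))) => z UVz.
have dz := dp z UVz; have [/df dfz /dg dgz] := UVz.
rewrite [RHS]deriveE; last exact: (@ex_diff _ _ _ _ _ _ _ dz).
by rewrite diff_val !deriveE.
Qed.

End Smooth.

Section Manifold.
Context {R : realType}.

(* [cbwd] is total; it is meaningful only on the open set [cfwd @` cdom]. *)
Record chart (T : topologicalType) (E : normedModType R) := Chart {
  cdom : set T;
  cfwd : T -> E;
  cbwd : E -> T;
  cdom_open : open cdom;
  cimg_open : open (cfwd @` cdom);
  cfwdK : forall x, cdom x -> cbwd (cfwd x) = x;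
  cfwd_cont : forall x, cdom x -> {for x, continuous cfwd};
  cbwd_cont : forall y, (cfwd @` cdom) y -> {for y, continuous cbwd} }.

Definition cimg (T : topologicalType) (E : normedModType R) (c : chart T E) :
  set E := cfwd c @` cdom c.

Definition smooth_transition (T : topologicalType) (E : normedModType R)
    (c d : chart T E) : Prop :=
  smooth_on (cfwd c @` (cdom c `&` cdom d)) (cfwd d \o cbwd c).

(* A smooth atlas on [T] modelled on [E], with a preferred chart [chart_at x]
   around each point.  The tangent space at [x] is [E] itself: [v : E] stands for
   the tangent vector whose coordinates in [chart_at x] are [v].  A vector field
   is thus a map [T -> E], a k-form a map [T -> E -> ... -> E -> R], and a
   (1,1)-tensor field a map [T -> E -> E]; smoothness and d are defined by going
   to coordinates.  Hausdorffness and second countability of [T] are separate. *)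
Record smooth_structure (T : topologicalType) (E : normedModType R) :=
  SmoothStructure {
    atlas : set (chart T E);
    chart_at : T -> chart T E;
    chart_at_atlas : forall x, atlas (chart_at x);
    chart_at_dom : forall x, cdom (chart_at x) x;
    atlas_smooth : forall c d, atlas c -> atlas d -> smooth_transition c d }.

Lemma open_setX (T T' : topologicalType) (A : set T) (B : set T') :
  open A -> open B -> open (A `*` B).
Proof.
move=> oA oB; rewrite openE => -[x y] [Ax By] /=.
by exists (A, B) => //=; split; exact: open_nbhs_nbhs.
Qed.

Lemma img_setX (T T' U U' : Type) (f : T -> U) (g : T' -> U') A B :
  (fun z => (f z.1, g z.2)) @` (A `*` B) = (f @` A) `*` (g @` B).
Proof.
apply/seteqP; split=> [_ [[x y] [/= Ax By] <-]|[u v] /= [[x Ax <-] [y By <-]]].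
  by split=> /=; [exists x|exists y].
by exists (x, y).
Qed.

Lemma cont_prod (T T' U U' : topologicalType) (f : T -> U) (g : T' -> U') z :
  {for z.1, continuous f} -> {for z.2, continuous g} ->
  {for z, continuous (fun z : T * T' => (f z.1, g z.2))}.
Proof.
move=> cf cg; apply: cvg_pair => /=.
  by apply: continuous_comp; [exact: cvg_fst|exact: cf].
by apply: continuous_comp; [exact: cvg_snd|exact: cg].
Qed.

Section Product.
Context {S T : topologicalType} {E F : normedModType R}.

Program Definition prod_chart (a : chart S E) (b : chart T F) :
    chart (S * T)%type (E * F)%type :=
  @Chart _ _ (cdom a `*` cdom b) (fun z => (cfwd a z.1, cfwd b z.2))
    (fun w => (cbwd a w.1, cbwd b w.2)) _ _ _ _ _.
Next Obligation. by move=> a b; apply: open_setX; exact: cdom_open. Qed.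
Next Obligation.
by move=> a b; rewrite img_setX; apply: open_setX; exact: cimg_open.
Qed.
Next Obligation. by move=> a b [x y] [/= ax by_]; rewrite !cfwdK. Qed.
Next Obligation.
by move=> a b [x y] [/= ax by_]; apply: cont_prod; exact: cfwd_cont.
Qed.
Next Obligation.
move=> a b y; rewrite img_setX => -[ya yb].
by apply: cont_prod; exact: cbwd_cont.
Qed.

Definition prod_atlas (A : smooth_structure S E) (B : smooth_structure T F) :
    set (chart (S * T)%type (E * F)%type) :=
  [set prod_chart a b | a in atlas A & b in atlas B].

Lemma chart_overlap_open (T' : topologicalType) (E' : normedModType R)
  (c d : chart T' E') : open (cfwd c @` (cdom c `&` cdom d)).
Proof.
have -> : cfwd c @` (cdom c `&` cdom d) = cimg c `&` cbwd c @^-1` cdom d.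
  apply/seteqP; split=> [_ [x [cx dx] <-]|_ [[x cx <-]]].
    by split; [exists x|rewrite /preimage /= cfwdK].
  by rewrite /preimage /= cfwdK // => dx; exists x.
rewrite openE => y [cy dy]; apply: filterI.
  by apply: open_nbhs_nbhs; split=> //; exact: cimg_open.
apply: (cbwd_cont cy); apply: open_nbhs_nbhs; split=> //; exact: cdom_open.
Qed.

(* With these preferred charts the tangent space of the product at [(s, t)] is
   [E * F], the first component being tangent to [S], the second to [T]. *)
Program Definition prod_smooth (A : smooth_structure S E)
    (B : smooth_structure T F) : smooth_structure (S * T)%type (E * F)%type :=
  @SmoothStructure _ _ (prod_atlas A B)
    (fun z => prod_chart (chart_at A z.1) (chart_at B z.2)) _ _ _.
Next Obligation.
move=> A B [x y]; exists (chart_at A x); first exact: chart_at_atlas.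
by exists (chart_at B y) => //; exact: chart_at_atlas.
Qed.
Next Obligation. by move=> A B [x y]; split; exact: chart_at_dom. Qed.
Next Obligation.
move=> A B _ _ [a Aa [b Bb <-]] [a' Aa' [b' Bb' <-]] k.
rewrite /smooth_transition /= -setXI img_setX.
have oa := chart_overlap_open a a'; have ob := chart_overlap_open b b'.
exact: (@Ck_prod _ _ _ _ _ _ _ (cfwd a' \o cbwd a) (cfwd b' \o cbwd b) k oa ob
  (open_setX oa ob) (atlas_smooth Aa Aa' k) (atlas_smooth Bb Bb' k)).
Qed.
End Product.

Program Definition id_chart (E : normedModType R) : chart E E :=
  @Chart E E setT id id _ _ _ _ _.
Next Obligation. by move=> E; exact: openT. Qed.
Next Obligation. by move=> E; rewrite image_id; exact: openT. Qed.
Next Obligation. by []. Qed.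
Next Obligation. by move=> E x _; exact: cvg_id. Qed.
Next Obligation. by move=> E x _; exact: cvg_id. Qed.

Program Definition euclidean (E : normedModType R) : smooth_structure E E :=
  @SmoothStructure E E [set id_chart E] (fun=> id_chart E) _ _ _.
Next Obligation. by []. Qed.
Next Obligation. by []. Qed.
Next Obligation. move=> E c d -> ->; exact: smooth_id. Qed.

Definition real_line : smooth_structure R R := euclidean R.

Section Calculus.
Context {T : topologicalType} {E : normedModType R} (M : smooth_structure T E).
Implicit Types (c : chart T E) (x : T) (y u v w : E) (h : T -> R) (X : T -> E)
  (eta : T -> E -> R) (Om : T -> E -> E -> R) (phi : T -> E -> E).

(* Passage between the tangent space at [cbwd c y] and the coordinates of an
   arbitrary chart [c] at [y \in cimg c]. *)
Definition of_coord c y w : E :=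
  'D_w (cfwd (chart_at M (cbwd c y)) \o cbwd c) y.

Definition to_coord c y v : E :=
  let q := cbwd c y in
  'D_v (cfwd c \o cbwd (chart_at M q)) (cfwd (chart_at M q) q).

Definition coord_vf c X y : E := to_coord c y (X (cbwd c y)).

Definition coord_form1 c eta y w : R := eta (cbwd c y) (of_coord c y w).

Definition coord_form2 c Om y v w : R :=
  Om (cbwd c y) (of_coord c y v) (of_coord c y w).

Definition coord_endo c phi y w : E :=
  to_coord c y (phi (cbwd c y) (of_coord c y w)).

Definition smooth_fun h : Prop :=
  forall c, atlas M c -> smooth_on (cimg c) (h \o cbwd c).

Definition smooth_vf X : Prop :=
  forall c, atlas M c -> smooth_on (cimg c) (coord_vf c X).

Definition smooth_form1 eta : Prop :=
  (forall x, scalar (eta x)) /\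
  forall c, atlas M c -> forall w,
    smooth_on (cimg c) (fun y => coord_form1 c eta y w).

(* Smooth (0,2)-tensor fields; alternation or symmetry is not included. *)
Definition smooth_tensor02 Om : Prop :=
  [/\ forall x v, scalar (Om x v),
      forall x w, scalar (fun v => Om x v w) &
      forall c, atlas M c -> forall v w,
        smooth_on (cimg c) (fun y => coord_form2 c Om y v w)].

Definition smooth_endo phi : Prop :=
  (forall x, linear (phi x)) /\
  forall c, atlas M c -> forall w,
    smooth_on (cimg c) (fun y => coord_endo c phi y w).

(* Exterior derivative of functions, 1-forms and 2-forms, computed in the
   preferred chart at [x]. *)
Definition d0 h x v : R :=
  let c := chart_at M x in 'D_v (h \o cbwd c) (cfwd c x).

Definition d1 eta x v w : R :=
  let c := chart_at M x in
  'D_v (fun y => coord_form1 c eta y w) (cfwd c x)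
  - 'D_w (fun y => coord_form1 c eta y v) (cfwd c x).

Definition d2 Om x u v w : R :=
  let c := chart_at M x in
  'D_u (fun y => coord_form2 c Om y v w) (cfwd c x)
  - 'D_v (fun y => coord_form2 c Om y u w) (cfwd c x)
  + 'D_w (fun y => coord_form2 c Om y u v) (cfwd c x).

Definition wedge12 eta Om x u v w : R :=
  eta x u * Om x v w - eta x v * Om x u w + eta x w * Om x u v.

Definition closed1 eta : Prop := forall x v w, d1 eta x v w = 0.

Definition closed2 Om : Prop := forall x u v w, d2 Om x u v w = 0.

Definition exact1 eta : Prop :=
  exists2 h, smooth_fun h & forall x v, eta x v = d0 h x v.

Definition riemannian (g : T -> E -> E -> R) : Prop :=
  [/\ smooth_tensor02 g,
      forall x v w, g x v w = g x w v &
      forall x v, v != 0 -> 0 < g x v v].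

(* [J] comes from a complex atlas: around each point some chart compatible with
   the smooth structure turns [J] into a fixed complex structure [J0] of the
   vector space [E] (transitions between such charts are holomorphic). *)
Definition complex_structure (J : T -> E -> E) : Prop :=
  [/\ smooth_endo J,
      forall x v, J x (J x v) = - v &
      forall x, exists2 c, cdom c x &
        (forall d, atlas M d -> smooth_transition c d /\ smooth_transition d c) /\
        exists J0 : E -> E, forall y, cimg c y -> forall w, coord_endo c J y w = J0 w].

Definition hermitian (J : T -> E -> E) (G : T -> E -> E -> R) : Prop :=
  [/\ riemannian G, complex_structure J &
      forall x v w, G x (J x v) (J x w) = G x v w].

(* Fundamental 2-form, for a complex or an almost contact structure. *)
Definition kahler_form (G : T -> E -> E -> R) (J : T -> E -> E) :
    T -> E -> E -> R :=
  fun x v w => G x v (J x w).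

Definition conformal_kahler (J : T -> E -> E) (G : T -> E -> E -> R) : Prop :=
  hermitian J G /\
  exists2 omega, exact1 omega &
    forall x u v w,
      d2 (kahler_form G J) x u v w = wedge12 omega (kahler_form G J) x u v w.

End Calculus.

Section AlmostContact.
Context {m : nat} {T : topologicalType}.
Local Notation E := 'rV[R]_((2 * m).+1).
Context (M : smooth_structure T E).

Record almost_contact_metric (phi : T -> E -> E) (eta : T -> E -> R)
    (xi : T -> E) (g : T -> E -> E -> R) : Prop := AlmostContactMetric {
  acm_phi_smooth : smooth_endo M phi;
  acm_eta_smooth : smooth_form1 M eta;
  acm_xi_smooth : smooth_vf M xi;
  acm_riemannian : riemannian M g;
  acm_phi2 : forall x v, phi x (phi x v) = - v + eta x v *: xi x;
  acm_eta_xi : forall x, eta x (xi x) = 1;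
  acm_eta_phi : forall x v, eta x (phi x v) = 0;
  acm_phi_xi : forall x, phi x (xi x) = 0;
  acm_compat : forall x v w,
    g x (phi x v) (phi x w) = g x v w - eta x v * eta x w }.

Definition almost_kenmotsu (phi : T -> E -> E) (eta : T -> E -> R)
    (xi : T -> E) (g : T -> E -> E -> R) : Prop :=
  [/\ almost_contact_metric phi eta xi g,
      closed1 M eta &
      exists2 beta : T -> R, smooth_fun M beta &
        forall x u v w,
          d2 M (kahler_form g phi) x u v w
          = beta x * wedge12 eta (kahler_form g phi) x u v w].

End AlmostContact.

(* The product of the real line with [M]; a tangent vector at [(t, x)] is a pair
   [(a, v)] standing for a d/dt + v. *)
Section WarpedProduct.
Context {T : topologicalType} {E : normedModType R}.

Definition line_prod (M : smooth_structure T E) :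
    smooth_structure (R * T)%type (R * E)%type :=
  prod_smooth real_line M.

Definition lift_vf (X : T -> E) : R * T -> R * E := fun z => (0, X z.2).

Definition lift_form1 (eta : T -> E -> R) : R * T -> R * E -> R :=
  fun z V => eta z.2 V.2.

Definition lift_endo (phi : T -> E -> E) : R * T -> R * E -> R * E :=
  fun z V => (0, phi z.2 V.2).

Definition dt : R * T -> R * E -> R := fun _ V => V.1.

Definition ddt : R * T -> R * E := fun _ => (1, 0).

Definition warped_metric (p : R -> R) (g : T -> E -> E -> R) :
    R * T -> R * E -> R * E -> R :=
  fun z V W => dt z V * dt z W + p z.1 ^+ 2 * g z.2 V.2 W.2.

Definition induced_contact (p : R -> R) (phi : T -> E -> E)
    (eta0 : T -> E -> R) (xi0 : T -> E) (J : R * T -> R * E -> R * E) : Prop :=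
  let eta z V := p z.1 * lift_form1 eta0 z V in
  let xi z := (p z.1)^-1 *: lift_vf xi0 z in
  [/\ forall z V, eta z V = 0 -> dt z V = 0 -> J z V = lift_endo phi z V,
      forall z, J z (xi z) = - ddt z &
      forall z, J z (ddt z) = xi z].

End WarpedProduct.
End Manifold.

(* Main.v *)
(* In terms of the almost contact structure J (a, v) = (- p eta0 v, phi v + (a / p) xi0),
   so Omega_G ((a, v), (b, w)) = p^2 Omega_g (v, w) + p (b eta0 v - a eta0 w).
   The hypotheses make p constant and f = h a function on M alone, with
   dh = xi0(h) eta0.  Evaluating d (f Omega_G) = 0 on (d/dt, v, w) gives
   d (h eta0) = 0, hence d eta0 = 0 because dh /\ eta0 = 0; evaluating it on
   three vectors tangent to M gives d (h Omega_g) = 0, that is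
   d Omega_g = beta eta0 /\ Omega_g with beta = - xi0(h) / h. *)

Require Import Defs.
From HB Require Import structures.
From mathcomp Require Import all_boot all_order all_algebra.
From mathcomp Require Import all_classical all_reals all_analysis.
From mathcomp Require Import ring lra.
Set Implicit Arguments.
Unset Strict Implicit.
Unset Printing Implicit Defensive.
Import Order.TTheory GRing.Theory Num.Theory.
Import numFieldNormedType.Exports.
Local Open Scope classical_set_scope.
Local Open Scope ring_scope.

(** * Calculus of [Ck] maps between normed spaces *)

Section CkCalculus.
Context {R : realType}.
Implicit Types (E F G : normedModType R).

Lemma derive_comp E F G (b : E -> F) (a : F -> G) (x v : E) :
  differentiable b x -> differentiable a (b x) ->
  'D_v (a \o b) x = 'D_('D_v b x) a (b x).
Proof.
move=> db da; rewrite !deriveE//; last exact: differentiable_comp.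
by rewrite diff_comp.
Qed.

Lemma derive_lin E F (a : E -> F) (x : E) :
  differentiable a x -> linear (fun v => 'D_v a x).
Proof. by move=> da k u v; rewrite !deriveE// linearP. Qed.

(** Both sides are limits of one and the same difference quotient, so the identity holds for every
    [f]. *)
Lemma derive_slice_r E E' F (f : E * E' -> F) z (v : E') :
  'D_(0, v) f z = 'D_v (fun y => f (z.1, y)) z.2.
Proof.
rewrite /derive; set F1 := (X in lim (X @ _) = _); set F2 := (X in _ = lim (X @ _)).
suff -> : F1 = F2 by []; rewrite {}/F1 {}/F2; apply/funext => t /=.
case: z => a b /=; congr (_ *: (f (_, _) - _)).
by rewrite /= scaler0 add0r.
Qed.

Lemma derive_slice_l E E' F (f : E * E' -> F) z (u : E) :
  'D_(u, 0) f z = 'D_u (fun x => f (x, z.2)) z.1.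
Proof.
rewrite /derive; set F1 := (X in lim (X @ _) = _); set F2 := (X in _ = lim (X @ _)).
suff -> : F1 = F2 by []; rewrite {}/F1 {}/F2; apply/funext => t /=.
case: z => a b /=; congr (_ *: (f (_, _) - _)).
by rewrite /= scaler0 add0r.
Qed.

Lemma smooth_on_derive E F (U : set E) (f : E -> F) v :
  smooth_on U f -> smooth_on U (fun x => 'D_v f x).
Proof. by move=> sf k; have [_] := sf k.+1; apply. Qed.

Lemma smooth_on_differentiable E F (U : set E) (f : E -> F) x :
  smooth_on U f -> U x -> differentiable f x.
Proof. by move=> sf; have [+ _] := sf 1%N; apply. Qed.

Lemma smooth_on_ext E F (U : set E) (f g : E -> F) : open U ->
  (forall x, U x -> f x = g x) -> smooth_on U f -> smooth_on U g.
Proof. by move=> oU fg sf k; exact: Ck_ext oU fg (sf k). Qed.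

Lemma near_eq_open E F (U : set E) (f g : E -> F) x : open U -> U x ->
  (forall y, U y -> f y = g y) -> \forall y \near x, f y = g y.
Proof.
move=> oU Ux fg; have : nbhs x U by exact: open_nbhs_nbhs.
by apply: filterS => y /fg.
Qed.

(** The rules for derivatives of products and inverses leave undifferentiated factors; the
    inductions in [CkM] and [CkV] use these at one order lower. *)
Lemma CkS E F (U : set E) (f : E -> F) k : Ck k.+1 U f -> Ck k U f.
Proof.
elim: k f => [|k IH] f /= [df dfk].
  by move=> x Ux; exact/differentiable_continuous/df.
by split=> // v; apply: IH; exact: dfk.
Qed.

Lemma CkD E F (U : set E) (f g : E -> F) k : open U ->
  Ck k U f -> Ck k U g -> Ck k U (fun x => f x + g x).
Proof.
move=> oU; elim: k f g => [|k IH] f g /=.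
  by move=> cf cg x Ux; apply: cvgD; [exact: cf|exact: cg].
move=> [df dfk] [dg dgk]; split=> [x Ux|v].
  exact: differentiableD (df x Ux) (dg x Ux).
apply: (Ck_ext oU _ (IH _ _ (dfk v) (dgk v))) => x Ux.
by rewrite deriveD//; apply: diff_derivable; [exact: df|exact: dg].
Qed.

Lemma CkM E (U : set E) (f g : E -> R) k : open U ->
  Ck k U f -> Ck k U g -> Ck k U (fun x => f x * g x).
Proof.
move=> oU; elim: k f g => [|k IH] f g.
  by move=> /= cf cg x Ux; apply: cvgM; [exact: cf|exact: cg].
move=> Cf Cg; have [df dfk] := Cf; have [dg dgk] := Cg; rewrite /=.
split=> [x Ux|v].
  exact: differentiableM (df x Ux) (dg x Ux).
apply: (Ck_ext oU _ (CkD oU (IH _ _ (CkS Cf) (dgk v)) (IH _ _ (CkS Cg) (dfk v)))).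
by move=> x Ux; rewrite deriveM//; apply: diff_derivable; [exact: df|exact: dg].
Qed.

(** The derivative is [- (1/f)^2 * 'D_v f]; the induction hypothesis handles [1/f], and [CkM] the
    products. *)
Lemma CkV E (U : set E) (f : E -> R) k : open U ->
  (forall x, U x -> f x != 0) -> Ck k U f -> Ck k U (fun x => (f x)^-1).
Proof.
move=> oU f0; elim: k => [|k IH].
  by move=> /= cf x Ux; apply: cvgV; [exact: f0|exact: cf].
move=> Cf; have [df dfk] := Cf; rewrite /=; split=> [x Ux|v].
  by apply: differentiableV; [exact: df|exact: f0].
have Ci := IH (CkS Cf).
have Cm : Ck k U (fun x : E => - 1 : R) by exact: smooth_cst.
apply: (Ck_ext oU _ (CkM oU (CkM oU Cm (CkM oU Ci Ci)) (dfk v))) => x Ux.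
rewrite deriveV ?f0//; last exact/diff_derivable/df.
by rewrite mulN1r -expr2 exprVn.
Qed.

Lemma smooth_onM E (U : set E) (f g : E -> R) : open U ->
  smooth_on U f -> smooth_on U g -> smooth_on U (fun x => f x * g x).
Proof. by move=> oU sf sg k; exact: CkM. Qed.

Lemma smooth_onV E (U : set E) (f : E -> R) : open U ->
  (forall x, U x -> f x != 0) -> smooth_on U f ->
  smooth_on U (fun x => (f x)^-1).
Proof. by move=> oU f0 sf k; exact: CkV. Qed.

Lemma smooth_on_sum E (U : set E) (I : Type) (s : seq I) (f : I -> E -> R) :
  open U -> (forall i, smooth_on U (f i)) ->
  smooth_on U (fun x => \sum_(i <- s) f i x).
Proof.
move=> oU sf; elim: s => [|i s IH].
  by under eq_fun do rewrite big_nil; exact: smooth_cst.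
by under eq_fun do rewrite big_cons; move=> k; apply: CkD => //; exact: sf.
Qed.

Lemma Ck_coord E n (U : set E) (f : E -> 'rV[R]_n.+1) j k :
  open U -> Ck k U f -> Ck k U (fun x => f x 0 j).
Proof.
move=> oU; elim: k f => [|k IH] f /=.
  move=> cf x Ux; apply: (@continuous_comp _ _ _ f (fun N : 'rV[R]_n.+1 => N 0 j)).
    exact: cf.
  exact: coord_continuous.
move=> [df dfk]; split=> [x Ux|v].
  exact: differentiable_comp (df x Ux) (differentiable_coord _ _ _).
apply: (Ck_ext oU _ (IH _ (dfk v))) => x Ux.
by rewrite derive_mx ?mxE//; exact/diff_derivable/df.
Qed.

(** Deriving the slice along [v] gives the slice of the derivative along [(0, v)], so the induction
    stays among slices. *)
Lemma Ck_slice_r E E' F (U : set (E * E')) (V : set E') (f : E * E' -> F) a k :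
  (forall y, V y -> U (a, y)) -> Ck k U f -> Ck k V (fun y => f (a, y)).
Proof.
move=> UV; have cp y : {for y, continuous (fun y : E' => (a, y))}.
  by apply: cvg_pair; [exact: cvg_cst|exact: cvg_id].
elim: k f => [|k IH] f /=.
  move=> cf y /UV Uy; apply: (continuous_comp (cp y)); exact: cf.
move=> [df dfk]; split=> [y /UV Uy|v].
  have dp : differentiable (fun y : E' => (a, y)) y.
    by apply: differentiable_pair => //; exact: differentiable_cst.
  exact: differentiable_comp dp (df _ Uy).
have := IH _ (dfk (0, v)).
by under eq_fun do rewrite derive_slice_r.
Qed.

Lemma differentiable_slice_l E E' F (f : E * E' -> F) x y :
  differentiable f (x, y) -> differentiable (fun x => f (x, y)) x.
Proof.
move=> df; have dp : differentiable (fun x : E => (x, y)) x.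
  by apply: differentiable_pair => //; exact: differentiable_cst.
exact: differentiable_comp dp df.
Qed.

End CkCalculus.

(** * Change of charts *)

Section Coordinates.
Context {R : realType} {T : topologicalType} {E : normedModType R}.
Context (M : smooth_structure T E).
Implicit Types (c d : chart T E) (h : T -> R).

Lemma cimg_cfwd c x : cdom c x -> cimg c (cfwd c x).
Proof. by exists x. Qed.

Lemma cdom_cbwd c y : cimg c y -> cdom c (cbwd c y).
Proof. by move=> [x cx <-]; rewrite cfwdK. Qed.

Lemma cbwdK c y : cimg c y -> cfwd c (cbwd c y) = y.
Proof. by move=> [x cx <-]; rewrite cfwdK. Qed.

Lemma transition_differentiable c d x : atlas M c -> atlas M d ->
  cdom c x -> cdom d x -> differentiable (cfwd d \o cbwd c) (cfwd c x).
Proof.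
move=> Ac Ad cx dx; apply: (smooth_on_differentiable (atlas_smooth Ac Ad)).
by exists x.
Qed.

Lemma near_overlap c d x : cdom c x -> cdom d x ->
  \forall y \near cfwd c x, cdom c (cbwd c y) /\ cdom d (cbwd c y).
Proof.
move=> cx dx; have : nbhs (cfwd c x) (cfwd c @` (cdom c `&` cdom d)).
  apply: open_nbhs_nbhs; split; first exact: chart_overlap_open.
  by exists x.
by apply: filterS => _ [z [cz dz] <-]; rewrite cfwdK.
Qed.

(** The two opposite transition maps compose to the identity near the base point; the chain rule
    does the rest. *)
Lemma of_coordK c y v : atlas M c -> cimg c y ->
  of_coord M c y (to_coord M c y v) = v.
Proof.
move=> Ac cy; rewrite /of_coord /to_coord; set q := cbwd c y.
have cq : cdom c q by exact: cdom_cbwd.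
set d := chart_at M q; have dq : cdom d q by exact: chart_at_dom.
have Ad : atlas M d by exact: chart_at_atlas.
have yE : y = (cfwd c \o cbwd d) (cfwd d q) by rewrite /= cfwdK// cbwdK.
rewrite {1}yE -derive_comp; last 2 first.
- exact: transition_differentiable.
- by rewrite -yE -(cbwdK cy); exact: transition_differentiable.
rewrite -[RHS](derive_id (cfwd d q)); apply: near_eq_derive.
near=> z.
have [dz cz] : cdom d (cbwd d z) /\ cdom c (cbwd d z).
  by near: z; exact: near_overlap.
have zd : cimg d z.
  by near: z; apply: open_nbhs_nbhs; split; [exact: cimg_open|exact: cimg_cfwd].
by rewrite /= cfwdK// cbwdK.
Unshelve. all: by end_near. Qed.

Lemma of_coord_linear c y : atlas M c -> cimg c y -> linear (of_coord M c y).
Proof.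
move=> Ac cy; apply: derive_lin; rewrite -(cbwdK cy).
rewrite cfwdK; last exact: cdom_cbwd.
apply: transition_differentiable => //; first exact: chart_at_atlas.
  exact: cdom_cbwd.
exact: chart_at_dom.
Qed.

(** [d0] uses the preferred chart, which may change from point to point; the chain rule moves it to
    one fixed chart, where smoothness can be tested. *)
Lemma d0_coord h c y v : smooth_fun M h -> atlas M c -> cimg c y ->
  d0 M h (cbwd c y) v = 'D_(to_coord M c y v) (h \o cbwd c) y.
Proof.
move=> sh Ac cy; rewrite /d0 /to_coord; set q := cbwd c y.
have cq : cdom c q by exact: cdom_cbwd.
set d := chart_at M q; have dq : cdom d q by exact: chart_at_dom.
have Ad : atlas M d by exact: chart_at_atlas.
have yE : y = (cfwd c \o cbwd d) (cfwd d q) by rewrite /= cfwdK// cbwdK.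
rewrite [in RHS]yE -derive_comp; last 2 first.
- exact: transition_differentiable.
- by rewrite -yE; exact: smooth_on_differentiable (sh c Ac) cy.
apply: near_eq_derive; near=> z.
have [dz cz] : cdom d (cbwd d z) /\ cdom c (cbwd d z).
  by near: z; exact: near_overlap.
by rewrite /= cfwdK.
Unshelve. all: by end_near. Qed.

End Coordinates.

(** * Expansion in the standard basis of the model space *)

Section FiniteDimensional.
Context {R : realType} {T : topologicalType} {n : nat}.
Local Notation E := 'rV[R]_n.+1.
Context (M : smooth_structure T E).
Implicit Types (c : chart T E) (h : T -> R).

(** Smoothness of forms and tensors is given for constant coordinate vectors; this expansion reduces
    moving arguments to that case. *)
Lemma scalar_row_sum (l : E -> R) : scalar l ->
  forall v, l v = \sum_j v 0 j * l (delta_mx 0 j).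
Proof.
move=> sl v; pose L := GRing.isLinear.Build _ _ _ _ l sl.
pose l' : {linear E -> R} := HB.pack l L.
have lE u : l u = l' u by [].
rewrite lE [in LHS](row_sum_delta v) linear_sum.
by apply: eq_bigr => j _; rewrite linearZ lE.
Qed.

(** In a fixed chart [dh(X)] is a finite sum of components of [X] times partial derivatives of [h].
    Taking [X = xi0] gives the smoothness of [beta]. *)
Lemma smooth_d0_vf h X : smooth_fun M h -> smooth_vf M X ->
  smooth_fun M (fun x => d0 M h x (X x)).
Proof.
move=> sh sX c Ac; have oc : open (cimg c) by exact: cimg_open.
apply: (@smooth_on_ext _ _ _ _ (fun y => \sum_j
  coord_vf M c X y 0 j * 'D_(delta_mx 0 j) (h \o cbwd c) y)) => // [y cy|].
  rewrite /= d0_coord// (scalar_row_sum (l := fun v => 'D_v (h \o cbwd c) y))//.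
  by apply: derive_lin; exact: smooth_on_differentiable (sh c Ac) cy.
apply: smooth_on_sum => // j; apply: smooth_onM => //.
  by move=> k; apply: Ck_coord => //; exact: sX.
by apply: smooth_on_derive; exact: sh.
Qed.

Lemma smooth_kahler_form g phi c v w : atlas M c -> smooth_tensor02 M g ->
  smooth_endo M phi ->
  smooth_on (cimg c) (fun y => coord_form2 M c (kahler_form g phi) y v w).
Proof.
move=> Ac [gr gl sg] [pl sp]; have oc : open (cimg c) by exact: cimg_open.
apply: (@smooth_on_ext _ _ _ _ (fun y => \sum_j
  coord_endo M c phi y w 0 j * coord_form2 M c g y v (delta_mx 0 j))) => // [y cy|].
  rewrite /coord_form2 /kahler_form.
  (* Writing [phi w] as [of_coord] of its coordinates brings out the components of [coord_endo],
     along which [g] is then expanded. *)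
  rewrite -[phi _ _](of_coordK (M := M) (c := c) (y := y))//.
  rewrite (scalar_row_sum
    (l := fun u => g (cbwd c y) (of_coord M c y v) (of_coord M c y u)))//.
  by move=> k a b; rewrite of_coord_linear// gr.
apply: smooth_on_sum => // j; apply: smooth_onM => //; last exact: sg.
by move=> k; apply: Ck_coord => //; exact: sp.
Qed.

End FiniteDimensional.

(** * Product charts on the line times [M] *)

Section LineProduct.
Context {R : realType} {T : topologicalType} {E : normedModType R}.
Context (M : smooth_structure T E).
Implicit Types (c : chart T E) (f : R * T -> R).

Lemma prod_chart_line_atlas c : atlas M c ->
  atlas (line_prod M) (prod_chart (id_chart R) c).
Proof. by move=> Ac; exists (id_chart R); [|exists c]. Qed.

Lemma cimg_line c s y : cimg c y -> cimg (prod_chart (id_chart R) c) (s, y).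
Proof. by move=> [x cx <-]; exists (s, x). Qed.

Lemma smooth_fun_slice f t : smooth_fun (line_prod M) f ->
  smooth_fun M (fun x => f (t, x)).
Proof.
move=> sf c Ac k; have := sf _ (prod_chart_line_atlas Ac) k.
by apply: (@Ck_slice_r _ _ _ _ _ _ _ t) => y; exact: cimg_line.
Qed.

Lemma smooth_fun_line_differentiable f t x : smooth_fun (line_prod M) f ->
  differentiable (fun s => f (s, x)) t.
Proof.
move=> sf; pose c := chart_at M x; have cx : cdom c x by exact: chart_at_dom.
have Ac : atlas M c by exact: chart_at_atlas.
have := smooth_on_differentiable (sf _ (prod_chart_line_atlas Ac))
  (cimg_line t (cimg_cfwd cx)).
by move=> /differentiable_slice_l; rewrite -[in X in _ -> X](cfwdK cx).
Qed.

Lemma d0_line_prod_l f t x a :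
  d0 (line_prod M) f (t, x) (a, 0) = 'D_a (fun s => f (s, x)) t.
Proof.
by rewrite /d0 derive_slice_l -[in RHS](cfwdK (chart_at_dom M x)).
Qed.

Lemma d0_line_prod_r f z v :
  d0 (line_prod M) f z (0, v) = d0 M (fun x => f (z.1, x)) z.2 v.
Proof. by rewrite /d0 derive_slice_r. Qed.

(** The transition map between product charts is [(id, tau)], with [tau] a transition map of [M], so
    its differential is block diagonal. *)
Lemma of_coord_line_prod c s y a v : atlas M c -> cimg c y ->
  of_coord (line_prod M) (prod_chart (id_chart R) c) (s, y) (a, v) =
  (a, of_coord M c y v).
Proof.
move=> Ac cy; rewrite /of_coord /=; set tau := cfwd _ \o cbwd c.
have dtau : differentiable tau y.
  rewrite -(cbwdK cy); apply: (transition_differentiable (M := M)) => //.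
  - exact: chart_at_atlas.
  - exact: cdom_cbwd.
  - exact: chart_at_dom.
have cfst : continuous (@fst R E) by move=> z; exact: cvg_fst.
have csnd : continuous (@snd R E) by move=> z; exact: cvg_snd.
have dfst : is_diff (s, y) (@fst R E) fst.
  apply: DiffDef; first exact: (@linear_differentiable _ _ _ fst _ cfst).
  exact: (@diff_lin _ _ _ fst _ cfst).
have dsnd : is_diff (s, y) (@snd R E) snd.
  apply: DiffDef; first exact: (@linear_differentiable _ _ _ snd _ csnd).
  exact: (@diff_lin _ _ _ snd _ csnd).
have dts := is_diff_comp dsnd (@differentiableP _ _ _ tau ((s, y) : R * E).2 dtau).
have dp := is_diff_pair dfst dts.
rewrite (_ : _ \o _ = (fun w : R * E => (w.1, (tau \o snd) w))); last by [].
have d2 := @ex_diff _ _ _ _ _ _ _ dp.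
by rewrite !deriveE// diff_val.
Qed.

(** The transition of a chart to itself is the identity near the point. Hence forms keep their own
    values in the preferred chart at its base point. *)
Lemma of_coord_chart_at x v :
  of_coord M (chart_at M x) (cfwd (chart_at M x) x) v = v.
Proof.
have cx := chart_at_dom M x.
rewrite /of_coord cfwdK// -[RHS](derive_id (cfwd (chart_at M x) x)).
by apply: near_eq_derive; apply: near_eq_open (cimg_open (chart_at M x))
  (cimg_cfwd cx) _ => y cy /=; rewrite cbwdK.
Qed.

End LineProduct.

Lemma derive1_eq0_cst (R : realType) (f : R -> R) :
  (forall t, differentiable f t) -> (forall t, 'D_1 f t = 0) ->
  forall s t, f s = f t.
Proof.
move=> df f0 s t; apply: is_derive_0_is_cst => x; rewrite -(f0 x).
by apply: derivableP; exact: diff_derivable.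
Qed.

(** * [J] and its Kahler form in terms of the contact data *)

Section InducedContact.
Context {R : realType} {m : nat} {T : topologicalType}.
Local Notation E := 'rV[R]_((2 * m).+1).
Context {M : smooth_structure T E} {phi : T -> E -> E} {eta0 : T -> E -> R}.
Context {xi0 : T -> E} {g : T -> E -> E -> R}.
Context (acm : almost_contact_metric M phi eta0 xi0 g).

(** Compatibility with second argument [xi0] has left side [g (phi v) 0 = 0]. *)
Lemma acm_metric_xi x v : g x v (xi0 x) = eta0 x v.
Proof.
have := acm_compat acm x v (xi0 x); rewrite (acm_phi_xi acm) (acm_eta_xi acm).
have [[gr _ _] _ _] := acm_riemannian acm.
(* Linearity at [-1 *: 0 + 0] forces the value at [0] to vanish; the same device serves below for
   [eta0], [Om] and [of_coord]. *)
have -> : g x (phi x v) 0 = 0 by have := gr x (phi x v) (-1) 0 0; rewrite scaler0 addr0 /=; lra.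
by rewrite mulr1 => /eqP; rewrite eq_sym subr_eq0 => /eqP.
Qed.

(** [J] is prescribed on [D], [xi] and [ddt], so [(a, v)] is split along these three. *)
Lemma induced_contactE {p : R -> R} {J : R * T -> R * E -> R * E} :
  (forall t, 0 < p t) -> induced_contact p phi eta0 xi0 J ->
  (forall z, linear (J z)) -> forall z a v,
  J z (a, v) = (- (p z.1 * eta0 z.2 v), phi z.2 v + (a / p z.1) *: xi0 z.2).
Proof.
move=> p0 [JD Jxi Jdt] Jlin z a v; have pz0 : p z.1 != 0 by rewrite gt_eqF.
have [el _] := acm_eta_smooth acm; have [pl _] := acm_phi_smooth acm.
(* [w] is the part of [v] in the kernel of [eta0]; [phi] does not see the removed multiple of
   [xi0]. *)
pose w := (- eta0 z.2 v) *: xi0 z.2 + v.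
have pw : phi z.2 w = phi z.2 v by rewrite pl (acm_phi_xi acm) scaler0 add0r.
have Jw : J z (0, w) = (0, phi z.2 v).
  rewrite JD /lift_endo /dt//= ?pw// /lift_form1 /= el (acm_eta_xi acm).
  by rewrite /= /GRing.scale /=; ring.
have -> : (a, v) = a *: ddt z
    + ((p z.1 * eta0 z.2 v) *: ((p z.1)^-1 *: lift_vf xi0 z) + (0, w)).
  congr pair; rewrite /=.
    by rewrite /GRing.scale /=; ring.
  rewrite scaler0 add0r scalerA mulrAC divff// mul1r /w scaleNr addrA subrr.
  by rewrite add0r.
rewrite Jlin Jlin Jxi Jdt Jw; congr pair; rewrite /=.
  by rewrite /GRing.scale /=; ring.
by rewrite oppr0 scaler0 add0r scalerA addrC.
Qed.

(** This is [Omega_G = p^2 Omega_g + p eta0 /\ dt]; the [eta0 v] term arises from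
    [g v xi0 = eta0 v]. *)
Lemma kahler_form_warped {p : R -> R} {J : R * T -> R * E -> R * E} :
  (forall t, 0 < p t) -> induced_contact p phi eta0 xi0 J ->
  (forall z, linear (J z)) -> forall z a v b w,
  kahler_form (warped_metric p g) J z (a, v) (b, w) =
  p z.1 ^+ 2 * kahler_form g phi z.2 v w
  + p z.1 * (b * eta0 z.2 v - a * eta0 z.2 w).
Proof.
move=> p0 Jc Jlin z a v b w; have pz0 : p z.1 != 0 by rewrite gt_eqF.
have [[gr _ _] _ _] := acm_riemannian acm.
rewrite /kahler_form /warped_metric (induced_contactE p0 Jc Jlin) /dt /=.
by rewrite [phi _ _ + _]addrC gr acm_metric_xi /GRing.scale /=; field.
Qed.

End InducedContact.

(* The next two facts isolate the algebra of [d (h eta0) = 0] and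
   [d (h Omega) = 0] at a point
   where [h = k] and [dh = l eta0]: [ring] is very slow when it sees the
   coordinate expressions themselves. *)
Lemma linear_solve1 (R : realType) (q k l a b A B : R) :
  q != 0 -> k != 0 ->
  0 - - q * (k * A + b * (l * a)) + - q * (k * B + a * (l * b)) = 0 ->
  A - B = 0.
Proof.
move=> q0 k0 eq0; apply: (mulfI (mulf_neq0 q0 k0)).
by rewrite mulr0 -[RHS]eq0; ring.
Qed.

Lemma linear_solve2 (R : realType) (q k l a b e A B C a' b' e' : R) :
  q != 0 -> k != 0 ->
  q ^+ 2 * (k * A + a' * (l * a)) - q ^+ 2 * (k * B + b' * (l * b))
    + q ^+ 2 * (k * C + e' * (l * e)) = 0 ->
  A - B + C = -1 * l / k * (a * a' - b * b' + e * e').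
Proof.
move=> q0 k0 eq0; apply: (mulfI (mulf_neq0 (expf_neq0 2 q0) k0)).
apply/eqP; rewrite -subr_eq0 -[X in _ == X]eq0; apply/eqP; field.
exact: k0.
Qed.

(** * Closedness of [f Omega_G] evaluated in product charts *)

Unset Implicit Arguments.

Theorem corollary2 (R : realType) (m : nat) (T : topologicalType)
  (M : smooth_structure T 'rV[R]_((2 * m).+1))
  (T_hausdorff : hausdorff_space T) (T_second_countable : @second_countable T)
  (phi : T -> 'rV[R]_((2 * m).+1) -> 'rV[R]_((2 * m).+1))
  (eta0 : T -> 'rV[R]_((2 * m).+1) -> R)
  (xi0 : T -> 'rV[R]_((2 * m).+1))
  (g : T -> 'rV[R]_((2 * m).+1) -> 'rV[R]_((2 * m).+1) -> R)
  (acm : almost_contact_metric M phi eta0 xi0 g)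
  (p : R -> R) (p_smooth : smooth_fun real_line p) (p_gt0 : forall t, 0 < p t)
  (J : R * T -> R * 'rV[R]_((2 * m).+1) -> R * 'rV[R]_((2 * m).+1))
  (J_contact : induced_contact p phi eta0 xi0 J)
  (cK : conformal_kahler (line_prod M) J (warped_metric p g))
  (f : R * T -> R) (f_smooth : smooth_fun (line_prod M) f)
  (f_gt0 : forall z, 0 < f z)
  (f_closed : closed2 (line_prod M)
     (fun z V W => f z * kahler_form (warped_metric p g) J z V W))
  (df_eq : forall z V, d0 (line_prod M) f z V
     = d0 (line_prod M) f z (lift_vf xi0 z) * lift_form1 eta0 z V)
  (dp_eq0 : forall t a, d0 real_line p t a = 0) :
  almost_kenmotsu M phi eta0 xi0 g.
Proof.
have [[_ [[Jlin _] _ _] _] _] := cK.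
set P := p 0; have P0 : 0 < P by exact: p_gt0.
have pP t : p t = P.
  apply: derive1_eq0_cst => {}t; last exact: dp_eq0.
  have := p_smooth (id_chart R) erefl.
  by move=> /smooth_on_differentiable; apply; exists t.
pose h x := f (0, x).
have fh t x : f (t, x) = h x.
  apply: (derive1_eq0_cst (f := fun s => f (s, x))) => {}t.
    exact: smooth_fun_line_differentiable f_smooth.
  have [el _] := acm_eta_smooth acm.
  (* The vector d/dt has zero component along [M], so its derivative of [f] is a multiple of
     [eta0 x 0 = 0]. *)
  rewrite -(d0_line_prod_l M) df_eq /lift_form1 /=.
  by have := el x (-1) 0 0; rewrite scaler0 addr0 /= => e0; nra.
have h0 x : h x != 0 by rewrite gt_eqF ?f_gt0.
have sh : smooth_fun M h by exact: smooth_fun_slice f_smooth.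
have dh x v : d0 M h x v = d0 M h x (xi0 x) * eta0 x v.
  have := df_eq (0, x) (0, v).
  by rewrite /lift_vf /lift_form1 !d0_line_prod_r.
have [er es] := acm_eta_smooth acm.
have [gs _ _] := acm_riemannian acm.
have ps := acm_phi_smooth acm.
pose Om := kahler_form g phi.
pose fOm z V W := f z * kahler_form (warped_metric p g) J z V W.
(* The right side is free of [t], because [p] and [f] are constant along the line. *)
have coordE x t y a v b w : cimg (chart_at M x) y ->
    coord_form2 (line_prod M) (prod_chart (id_chart R) (chart_at M x)) fOm
      (t, y) (a, v) (b, w) =
    h (cbwd (chart_at M x) y) *
      (P ^+ 2 * coord_form2 M (chart_at M x) Om y v w
       + P * (b * coord_form1 M (chart_at M x) eta0 y v
              - a * coord_form1 M (chart_at M x) eta0 y w)).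
  move=> cy; have Ac := chart_at_atlas M x.
  rewrite /coord_form2 /coord_form1 /fOm !of_coord_line_prod//.
  by rewrite (kahler_form_warped acm p_gt0 J_contact Jlin) /= fh pP.
have baseE x : let c := chart_at M x in let y := cfwd c x in
    [/\ cimg c y, h (cbwd c y) = h x,
     forall v w, coord_form2 M c Om y v w = Om x v w &
     forall v, coord_form1 M c eta0 y v = eta0 x v].
  move=> c y; have cx : cdom c x by exact: chart_at_dom.
  split; [exact: cimg_cfwd|by rewrite cfwdK| |].
    by move=> v w; rewrite /coord_form2 !of_coord_chart_at cfwdK.
  by move=> v; rewrite /coord_form1 of_coord_chart_at cfwdK.
(* Leibniz rule for [k * h * K] with [dh = xi0(h) eta0] inserted. It serves twice: for [eta0] with
   [k = - P] and for [Om] with [k = P ^+ 2]. The base value [K0] is separate so that it can be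
   replaced by a value of the form itself. *)
have dprod x k K K0 V W u :
    let c := chart_at M x in let y := cfwd c x in
    smooth_on (cimg c) K -> K y = K0 ->
    (forall y, cimg c y -> coord_form2 (line_prod M)
      (prod_chart (id_chart R) c) fOm (0, y) V W = k * (h (cbwd c y) * K y)) ->
    'D_(0, u) (fun y => coord_form2 (line_prod M)
      (prod_chart (id_chart R) c) fOm y V W) (0, y) =
    k * (h x * 'D_u K y + K0 * (d0 M h x (xi0 x) * eta0 x u)).
  move=> c y sK <- KE; have [cy hE _ _] := baseE x.
  have dH : derivable (h \o cbwd c) y u.
    apply: diff_derivable; apply: smooth_on_differentiable cy.
    by apply: sh; exact: chart_at_atlas.
  have dK : derivable K y u.
    by apply: diff_derivable; exact: smooth_on_differentiable sK cy.
  rewrite derive_slice_r /= (near_eq_derive _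
    (near_eq_open (cimg_open c) cy KE)).
  rewrite (deriveZ k (derivableM dH dK)) (deriveM dH dK) -dh.
  by rewrite [(h \o _) _]hE.
have Om0 x y w : cimg (chart_at M x) y ->
    coord_form2 M (chart_at M x) Om y 0 w = 0.
  move=> cy; have [_ gl _] := gs.
  have := gl (cbwd (chart_at M x) y)
    (phi (cbwd (chart_at M x) y) (of_coord M (chart_at M x) y w)) (-1) 0 0.
  have := of_coord_linear (chart_at_atlas M x) cy (-1) 0 0.
  rewrite !scaler0 !addr0 => o0; rewrite /coord_form2 /Om /kahler_form.
  by rewrite (_ : of_coord _ _ _ 0 = 0)/=; [lra|rewrite o0 scaleN1r addNr].
have etas x v : smooth_on (cimg (chart_at M x))
    (fun y => coord_form1 M (chart_at M x) eta0 y v).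
  by apply: es; exact: chart_at_atlas.
have Oms x v w : smooth_on (cimg (chart_at M x))
    (fun y => coord_form2 M (chart_at M x) Om y v w).
  by apply: smooth_kahler_form => //; exact: chart_at_atlas.
(* The three terms of [d2] become variables, so that the closing algebra never meets coordinate
   expressions. *)
have closedE x U V W (a b e : R) :
    let D U V W := 'D_U (fun y => coord_form2 (line_prod M)
      (prod_chart (id_chart R) (chart_at M x)) fOm y V W)
      (0, cfwd (chart_at M x) x) in
    D U V W = a -> D V U W = b -> D W U V = e -> a - b + e = 0.
  by move=> D <- <- <-; exact: f_closed (0, x) U V W.
have derive_dt0 x v w :
    'D_(1, 0) (fun y => coord_form2 (line_prod M)
      (prod_chart (id_chart R) (chart_at M x)) fOm y (0, v) (0, w))
      (0, cfwd (chart_at M x) x) = 0.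
  have [cy _ _ _] := baseE x.
  rewrite derive_slice_l; under eq_fun do rewrite coordE//.
  exact: derive_cst.
(* Pairing with d/dt kills the [Om] term and leaves [- P * h * eta0]. *)
have fOm_eta x v y : cimg (chart_at M x) y ->
    coord_form2 (line_prod M) (prod_chart (id_chart R) (chart_at M x)) fOm
      (0, y) (1, 0) (0, v) =
    - P * (h (cbwd (chart_at M x) y) * coord_form1 M (chart_at M x) eta0 y v).
  move=> cy; rewrite coordE// Om0// mulr0 add0r mul0r mul1r sub0r.
  by rewrite !mulrN mulNr mulrCA.
have fOm_Om x v w y : cimg (chart_at M x) y ->
    coord_form2 (line_prod M) (prod_chart (id_chart R) (chart_at M x)) fOm
      (0, y) (0, v) (0, w) =
    P ^+ 2 * (h (cbwd (chart_at M x) y) * coord_form2 M (chart_at M x) Om y v w).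
  have alg (q k l a b : R) : k * (q * l + P * (0 * a - 0 * b)) = q * (k * l).
    by ring.
  by move=> cy; rewrite coordE// alg.
split => // [x v w|].
  have [_ _ _ etaE] := baseE x.
  (* On [(d/dt, v, w)] the two terms from [dh] are [xi0(h) eta0(v) eta0(w)] with opposite signs;
     they cancel, leaving [P * h * d eta0 = 0]. *)
  exact: (linear_solve1 (lt0r_neq0 P0) (h0 x)
    (closedE x (1, 0) (0, v) (0, w) _ _ _ (derive_dt0 x v w)
      (dprod x _ _ _ _ _ v (etas x w) (etaE w) (fOm_eta x w))
      (dprod x _ _ _ _ _ w (etas x v) (etaE v) (fOm_eta x v)))).
(* Solving [h dOm + xi0(h) eta0 /\ Om = 0] for [dOm] gives this [beta]. The factor [-1 *] lets
   smoothness follow from closure under products and inverses. *)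
exists (fun x => -1 * d0 M h x (xi0 x) / h x).
  move=> c Ac; have oc : open (cimg c) by exact: cimg_open.
  apply: smooth_onM => //; last by apply: smooth_onV => //; exact: sh.
  apply: smooth_onM => //; first exact: smooth_cst.
  by apply: smooth_d0_vf Ac => //; exact: acm_xi_smooth acm.
move=> x u v w; have [_ _ OmE _] := baseE x.
have dOm V W Z := dprod x _ _ _ _ _ Z (Oms x V W) (OmE V W) (fOm_Om x V W).
exact: (linear_solve2 (lt0r_neq0 P0) (h0 x)
  (closedE x (0, u) (0, v) (0, w) _ _ _ (dOm v w u) (dOm u w v) (dOm u v w))).
Qed.
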